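(* Any accessible group $G$ with infinitely many ends has property $R_\infty$. In particular, any finitely presented group with infinitely many ends has property $R_\infty$.
   Context: Twisted conjugacy: for a group $G$ and $\varphi\in\mathrm{Aut}(G)$ (acting on the right), write $x\sim_\varphi y$ if there is $w\in G$ with $(w\varphi)\,x\,w^{-1}=y$; this is an equivalence relation on $G$. $G$ has property $R_\infty(\varphi)$ if $\sim_\varphi$ has infinitely many equivalence classes, and $G$ has property $R_\infty$ if it has $R_\infty(\varphi)$ for every $\varphi\in\mathrm{Aut}(G)$. Ends: for a finitely generated group $G$ with finite generating set $S$ and Cayley graph $\Gamma$, the number of ends of $G$ is the supremum of the number of infinite components of $\Gamma\setminus F$, over all finite subgraphs $F$ of $\Gamma$ (independent of $S$). Accessibility: a simplicial $G$-tree (a simplicial tree with an action of $G$ by automorphisms) is called terminal if all its vertex stabilisers have at most one end and all its edge stabilisers are finite. A group $G$ is accessible if it is finitely generated and admits a terminal $G$-tree. *)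

(* Defs.v *)
(* MathComp with the classical layer of MathComp-Analysis.  Groups are
   `groupType`s (not necessarily finite); subgroups and generating sets are
   classical sets `set G`. *)
From Stdlib Require Import Relation_Operators.
From HB Require Import structures.
From mathcomp Require Import all_boot all_classical.

Set Implicit Arguments.
Unset Strict Implicit.
Unset Printing Implicit Defensive.

Local Open Scope classical_set_scope.
Local Open Scope group_scope.

(* An automorphism acting on the right of its argument, [w phi], is written as
   the function application [phi w]. *)
Definition twisted_conj (G : groupType) (phi : G -> G) (x y : G) : Prop :=
  exists w : G, phi w * x * w^-1 = y.

Definition twisted_classes (G : groupType) (phi : G -> G) : set (set G) :=
  range (fun x => [set y | twisted_conj phi x y]).

Definition R_infty (G : groupType) : Prop :=
  forall phi : {multiplicative G -> G},
    bijective phi -> infinite_set (twisted_classes phi).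

(* A graph is given by its adjacency relation. *)
Definition component (T : choiceType) (e : rel T) (V : set T) (x : T) : set T :=
  [set y | exists2 p : seq T,
     path [rel u v | [&& u \in V, v \in V & e u v]] x p & y = last x p].

(* The infinite connected components of the subgraph of [e] induced on [V]. *)
Definition infinite_components (T : choiceType) (e : rel T) (V : set T) :
    set (set T) :=
  [set C | (exists2 x, V x & C = component e V x) /\ infinite_set C].

Definition subgroup_generated (G : groupType) (S : set G) : set G :=
  smallest [set H : set G | group_closed [pred x | x \in H]] S.

Definition fin_gen_by (G : groupType) (H S : set G) : Prop :=
  finite_set S /\ subgroup_generated S = H.

Definition finitely_generated (G : groupType) : Prop :=
  exists S : set G, fin_gen_by [set: G] S.

(* Edges join [g] and [g * s] for [s] in [S].  Loops, multiple edges and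
   orientations are forgotten, as they do not affect components. *)
Definition cayley (G : groupType) (S : set G) : rel G :=
  [rel x y | (x^-1 * y \in S) || (y^-1 * x \in S)].

(* [k] bounds the number of infinite components left by removing a finite
   subgraph from the Cayley graph of [H].  Here [F] is the vertex set of the
   subgraph: a subgraph contains the endpoints of its edges, so removing it
   amounts to removing its vertices together with all incident edges. *)
Definition ends_ubound (G : groupType) (H S : set G) (k : nat) : Prop :=
  forall F : set G, finite_set F -> F `<=` H ->
    (infinite_components (cayley S) (H `\` F) #<= `I_k)%card.

(* The supremum, i.e. least upper bound, in the extended natural numbers;
   [None] stands for infinity. *)
Definition cayley_ends (G : groupType) (H S : set G) : option nat :=
  if pselect (exists k, `[< ends_ubound H S k >]) is left bounded
  then Some (ex_minn bounded) else None.

(* The subgroup [H] is finitely generated and its number of ends is [n]; the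
   value does not depend on the finite generating set. *)
Definition has_ends (G : groupType) (H : set G) (n : option nat) : Prop :=
  exists2 S : set G, fin_gen_by H S & cayley_ends H S = n.

Definition infinitely_many_ends (G : groupType) : Prop :=
  has_ends [set: G] None.

Definition at_most_one_end (G : groupType) (H : set G) : Prop :=
  exists2 n : nat, has_ends H (Some n) & (n <= 1)%N.

Record simplicial_tree (T : choiceType) (e : rel T) : Prop := SimplicialTree {
  tree_nonempty : [set: T] !=set0;
  tree_sym : symmetric e;
  tree_irr : irreflexive e;
  tree_connected : forall x y : T, exists2 p, path e x p & y = last x p;
  tree_acyclic : forall c : seq T, (2 < size c)%N -> ~~ ucycleb e c
}.

Record graph_action (G : groupType) (T : choiceType) (e : rel T)
    (a : G -> T -> T) : Prop := GraphAction {
  graph_act1 : forall x, a 1 x = x;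
  graph_actM : forall g h x, a (g * h) x = a g (a h x);
  graph_act_adj : forall g x y, e (a g x) (a g y) = e x y
}.

Definition vertex_stab (G : groupType) (T : choiceType) (a : G -> T -> T)
    (x : T) : set G :=
  [set g | a g x = x].

(* Setwise, so inversions of the edge are included; the pointwise stabiliser
   has index at most 2 in it. *)
Definition edge_stab (G : groupType) (T : choiceType) (a : G -> T -> T)
    (x y : T) : set G :=
  [set g | a g @` [set x; y] = [set x; y]].

Record terminal_tree (G : groupType) (T : choiceType) (e : rel T)
    (a : G -> T -> T) : Prop := TerminalTree {
  terminal_is_tree : simplicial_tree e;
  terminal_is_action : graph_action e a;
  terminal_vertex : forall x, at_most_one_end (vertex_stab a x);
  terminal_edge : forall x y, e x y -> finite_set (edge_stab a x y)
}.

Definition accessible (G : groupType) : Prop :=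
  finitely_generated G /\
  exists (T : choiceType) (e : rel T) (a : G -> T -> T), terminal_tree e a.

(* Words in the letters [x_i] (encoded [(i, false)]) and [x_i^-1] (encoded
   [(i, true)]), [i < n]. *)
Definition word (n : nat) := seq ('I_n * bool).

Definition word_eval (G : groupType) (n : nat) (x : 'I_n -> G) (w : word n) :
    G :=
  \prod_(l <- w) (if l.2 then (x l.1)^-1 else x l.1).

Definition word_insertion (n : nat) (rs : seq (word n)) (u v : word n) : Prop :=
  exists p q r : word n,
    [/\ u = p ++ q, v = p ++ r ++ q
      & r \in rs \/ exists i b, r = [:: (i, b); (i, ~~ b)]].

(* [x] induces an isomorphism onto [G] from the group presented by the
   generators [x_i] and the relators [rs], i.e. the words modulo insertion and
   deletion of relators and of inverse pairs of letters. *)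
Definition presents (G : groupType) (n : nat) (x : 'I_n -> G)
    (rs : seq (word n)) : Prop :=
  (forall g : G, exists w : word n, word_eval x w = g) /\
  (forall u v : word n, word_eval x u = word_eval x v <->
     clos_refl_sym_trans (word n) (word_insertion rs) u v).

Definition finitely_presented (G : groupType) : Prop :=
  exists (n : nat) (x : 'I_n -> G) (rs : seq (word n)), presents x rs.

(* Main.v *)
Require Import Defs.
From mathcomp Require Import all_boot.
From mathcomp Require Import finmap zify all_classical.

(* Call a subset of the finitely generated group G almost invariant if every right
   translation changes it by a finite set; left translations and automorphisms
   permute these sets.  There are an almost invariant B and W in G such that, up to
   finite sets, every almost invariant D with infinite D and complement has a left
   translate between B and W B: the annulus from B to W B realises each of finitely
   many local "turns", and the boundary of D must make one of these turns somewhere.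
   Applied to D = psi(B), psi an automorphism, this puts a G-translate of B inside
   every annulus g psi(B), g psi(W B).  Only finitely many G-translates of B separate
   two given vertices, where a vertex is the majority vote of three ends.  So the
   length of a chain of nested annuli between two vertices is bounded, although the
   annuli range over an orbit of the whole holomorph of G.

   Twisted conjugation of x by w amounts to conjugation of the bijection
   T_x : v |-> x^-1 phi(v) by the left translation by w.  The largest k for which
   B, W B, ..., W^k B and T_x B are nested, up to translation, is therefore an
   invariant of the twisted conjugacy class.  It is finite by the bound on chains,
   and it is at least k for x = u W^-k, where u B is contained in phi(B). *)

Set Implicit Arguments.
Unset Strict Implicit.
Unset Printing Implicit Defensive.

Local Open Scope classical_set_scope.
Local Open Scope group_scope.

(** * Almost invariant sets *)

Section AlmostAll.
Context {T : Type}.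
Implicit Types P Q : T -> Prop.

Definition almost_all P := finite_set [set x | ~ P x].

Lemma aeW P : (forall x, P x) -> almost_all P.
Proof.
by move=> h; rewrite /almost_all; have -> : [set x | ~ P x] = set0
  by rewrite -subset0 => x /= /(_ (h x)).
Qed.

Lemma ae_mp P Q : almost_all P -> almost_all (fun x => P x -> Q x) -> almost_all Q.
Proof.
move=> hP hPQ; apply: sub_finite_set (_ : _ `<=` [set x | ~ P x] `|` [set x | ~ (P x ->
  Q x)]) _.
  by move=> x /= nQ; case: (pselect (P x)) => hp; [right=> /(_ hp)|left].
by rewrite finite_setU.
Qed.

Lemma aeS P Q : (forall x, P x -> Q x) -> almost_all P -> almost_all Q.
Proof. by move=> PQ /ae_mp; apply; apply: aeW. Qed.

Lemma aeI P Q : almost_all P -> almost_all Q -> almost_all (fun x => P x /\ Q x).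
Proof. by move=> hP hQ; apply: ae_mp hP _; apply: aeS hQ. Qed.

Lemma ae_forall (I : finType) (P : I -> T -> Prop) :
  (forall i, almost_all (P i)) -> almost_all (fun x => forall i, P i x).
Proof.
move=> h; apply: sub_finite_set (_ : _ `<=` \bigcup_(i in [set: I]) [set x | ~ P i x]) _.
  by move=> x /= /existsNP[i hi]; exists i.
by apply: bigcup_finite => [|i _]; [exact: finite_finset|exact: h].
Qed.

Lemma finite_ae (A : set T) : finite_set A <-> almost_all (fun x => ~ A x).
Proof.
rewrite /almost_all; have -> // : [set x | ~ ~ A x] = A.
by apply/seteqP; split => x /=; [move/contrapT|move=> ? ?].
Qed.

Lemma ae_ex (A : set T) P : infinite_set A -> almost_all P -> exists2 x, A x & P x.
Proof.
move=> iA hP; apply: contrapT => /forall2NP h; apply: iA; apply/finite_ae.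
by apply: aeS hP => x px ax; case: (h x).
Qed.

Lemma ae_can (f g : T -> T) P : cancel f g -> almost_all P -> almost_all (fun x => P (f x)).
Proof.
move=> fK hP; apply: sub_finite_set (_ : _ `<=` g @` [set x | ~ P x]) _.
  by move=> x /= nP; exists (f x).
exact: finite_image.
Qed.

End AlmostAll.

Lemma setI_disjoint T (X Y : set T) x : X `&` Y = set0 -> X x -> Y x -> False.
Proof. by move=> h Xx Yx; rewrite -[False]/(set0 x) -h. Qed.

Lemma setU_cover T (X Y : set T) x : X `|` Y = setT -> ~ X x -> Y x.
Proof. by move=> h nX; have [] : (X `|` Y) x by rewrite h. Qed.

Lemma subgroup_generated_ind (G : groupType) (S H : set G) : subgroup_generated S = setT ->
  H 1 -> (forall g h, H g -> H h -> H (g / h)) -> S `<=` H -> forall g, H g.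
Proof.
move=> gS H1 HF SH g.
have HH : group_closed [pred x | x \in H].
  by split; [rewrite !inE|move=> x y; rewrite !inE; exact: HF].
have : subgroup_generated S `<=` H by apply: smallest_sub.
by rewrite gS; apply.
Qed.

(** * Left translates, almost invariance and nestedness *)

Section Group.
Context {G : groupType}.
Implicit Types (X Y Z B D P : set G) (c g h x y z : G).

Definition translate c X : set G := [set x | X (c^-1 * x)].

Lemma translateM c g X : translate c (translate g X) = translate (c * g) X.
Proof. by rewrite /translate; apply/seteqP; split=> x /=; rewrite invgM mulgA. Qed.

Lemma translate1 X : translate 1 X = X.
Proof. by apply/seteqP; split=> x /=; rewrite /translate /= invg1 mul1g. Qed.

Lemma translate_mul c X x : translate c X (c * x) = X x.
Proof. by rewrite /translate /= mulKg. Qed.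

Lemma translateE c X x : translate c X x = X (c^-1 * x).
Proof. by []. Qed.

Lemma translate_sub c X Y : X `<=` Y -> translate c X `<=` translate c Y.
Proof. by move=> h x; exact: h. Qed.

Lemma ae_inv (P : G -> Prop) : almost_all P -> almost_all (fun x => P x^-1).
Proof. exact: (ae_can invgK). Qed.

Lemma ae_mulr g (P : G -> Prop) : almost_all P -> almost_all (fun x => P (x * g)).
Proof. exact: (ae_can (g := fun x => x * g^-1) (mulgK g)). Qed.

Lemma ae_mull g (P : G -> Prop) : almost_all P -> almost_all (fun x => P (g * x)).
Proof. exact: (ae_can (mulKg g)). Qed.

(* Right translations, so that left translations and automorphisms preserve the
   notion. *)
Definition almost_invariant X := forall g, almost_all (fun x => X x -> X (x * g)).

Lemma aiP X : almost_invariant X -> forall g, almost_all (fun x => X (x * g) <-> X x).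
Proof.
move=> aX g; apply: ae_mp (aX g) _; apply: ae_mp (ae_mulr g (aX g^-1)) _.
by apply: aeW => x; rewrite mulgK; split.
Qed.

Lemma aiC X : almost_invariant X -> almost_invariant (~` X).
Proof. move=> aX g; by apply: aeS (aiP aX g) => x [h _] nX Xg; apply/nX/h. Qed.

Lemma aiI X Y : almost_invariant X -> almost_invariant Y -> almost_invariant (X `&` Y).
Proof.
move=> aX aY g; apply: ae_mp (aX g) _; apply: aeS (aY g) => x h1 h2 [? ?].
by split; [apply: h2|apply: h1].
Qed.

Lemma ai_ae X Y : almost_invariant X -> almost_all (fun x => X x <-> Y x) ->
  almost_invariant Y.
Proof.
move=> aX h g; have hg := ae_mulr g h; apply: ae_mp h _; apply: ae_mp hg _.
by apply: aeS (aX g) => x XX YX XY /XY/XX/YX.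
Qed.

Lemma ai_translate c X : almost_invariant X -> almost_invariant (translate c X).
Proof.
move=> aX g; apply: aeS (ae_mull c^-1 (aX g)) => x.
by rewrite /translate /= mulgA.
Qed.

Lemma almost_all_mulr_iff X b : almost_invariant X ->
  almost_all (fun c => X c <-> X (c * b)).
Proof. by move=> aX; apply: aeS (aiP aX b) => x [? ?]; split. Qed.

(** Since [c^-1 * q = (c^-1 * p) * (p^-1 * q)], this is almost invariance under [p^-1 * q], read
    through the bijection sending [c] to [c^-1 * p]. *)
Lemma ae_unsep X p q : almost_invariant X -> almost_all (fun c => translate c X p ->
  translate c X q).
Proof.
move=> aX; apply: aeS (ae_inv (ae_mulr p (aX (p^-1 * q)))) => c.
by rewrite /translate /= mulgA mulgK.
Qed.

Lemma translate_neq X Y p q : almost_invariant X -> Y p -> ~ Y q ->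
  almost_all (fun c => translate c X <> Y).
Proof.
move=> aX Yp Yq; apply: aeS (ae_unsep p q aX) => c h e.
by move: h; rewrite e => /(_ Yp).
Qed.

Lemma translate_neq_self X p q : almost_invariant X -> X p -> ~ X q ->
  almost_all (fun c => translate c X <> X).
Proof. exact: translate_neq. Qed.

Hypothesis fg : finitely_generated G.

(** Connectedness of the Cayley graph, in a form free of paths. *)
Lemma fg_closed : exists2 s : seq G, (forall g, g \in s -> g^-1 \in s) &
  forall X, X !=set0 -> (forall x g, g \in s -> X x -> X (x * g)) -> X = setT.
Proof.
have [S [/finite_seqP[s eS] gS]] := fg.
exists (s ++ [seq g^-1 | g <- s]).
  move=> g; rewrite !mem_cat => /orP[gs|/mapP[h hs ->]].
    by rewrite (map_f _ gs) orbT.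
  by rewrite invgK hs.
move=> X [x0 Xx0] clX.
pose H : set G := [set g | forall x, (X x -> X (x * g)) /\ (X x -> X (x * g^-1))].
have SH : S `<=` H.
  rewrite eS => g /= gs x; split; apply: clX; rewrite mem_cat ?gs //.
  by rewrite map_f ?orbT.
have HT : forall g, H g.
  apply: subgroup_generated_ind gS _ _ SH => [x|g h Hg Hh x].
    by rewrite invg1 mulg1.
  split; first by rewrite mulgA => /(proj1 (Hg x))/(proj2 (Hh _)).
  by rewrite invgF mulgA => /(proj1 (Hh x))/(proj2 (Hg _)).
apply/seteqP; split => // y _.
by have [+ _] := HT (x0^-1 * y) x0; rewrite mulVKg; apply.
Qed.

Lemma finite_boundary X (s : seq G) : almost_invariant X ->
  exists K : seq G, forall x g, g \in s -> X x -> ~ X (x * g) -> x \in K.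
Proof.
move=> aX; have /finite_seqP[K eK] := ae_forall (fun i : 'I_(size s) => aX (nth 1 s i)).
exists K => x g /(nthP 1)[i ilt <-] Xx nX.
suff : [set` K] x by [].
by rewrite -eK /= => /(_ (Ordinal ilt) Xx).
Qed.

(** Nestedness: one of the four intersections of [X] or its complement with [Y] or its complement is
    empty. *)
Definition corner X Y :=
  [\/ X `&` Y = set0, X `<=` Y, Y `<=` X | X `|` Y = setT].

Lemma cornerC X Y : corner X Y -> corner (~` X) Y.
Proof.
case=> h; [apply: Or43|apply: Or44|apply: Or41|apply: Or42].
- by move=> x Yx Xx; have : (X `&` Y) x by []; rewrite h.
- by apply/seteqP; split => // x _; case: (pselect (X x)); [right; exact: h|left].
- by rewrite -subset0 => x [? /h].
- move=> x nX; have : (X `|` Y) x by rewrite h.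
  by case.
Qed.

Lemma corner_sym X Y : corner X Y -> corner Y X.
Proof. by case=> h; [apply: Or41; rewrite setIC|apply: Or43|apply: Or42|apply: Or44;
  rewrite setUC]. Qed.

Lemma cornerCE X Y : corner (~` X) Y -> corner X Y.
Proof. by move=> /cornerC; rewrite setCK. Qed.

Lemma ae_unsplit X (s : seq G) : almost_invariant X ->
  almost_all (fun c => (forall p, p \in s -> translate c X p) \/ (forall p, p \in s ->
    ~ translate c X p)).
Proof.
case: s => [|p0 s] aX; first by apply: aeW => c; left.
have := ae_forall (fun i : 'I_(size (p0 :: s)) =>
  aeI (ae_unsep p0 (nth p0 (p0 :: s) i) aX) (ae_unsep (nth p0 (p0 :: s) i) p0 aX)).
apply: aeS => c h.
have {}h p : p \in p0 :: s -> translate c X p0 <-> translate c X p.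
  move=> /(nthP p0)[i ilt <-]; have [? ?] := h (Ordinal ilt); by split.
by case: (pselect (translate c X p0)) => hp; [left|right] => p /h; tauto.
Qed.

(* When neither translate splits the boundary of the other set, one of the four
   corners is invariant under the generators, hence empty. *)
Lemma nested X Y : almost_invariant X -> almost_invariant Y ->
  almost_all (fun c => corner (translate c X) Y).
Proof.
have [s sV gens] := fg_closed.
move=> aX aY.
have [K hK] := finite_boundary s aY; have [K' hK'] := finite_boundary s (aiC aY).
have [L hL] := finite_boundary s aX; have [L' hL'] := finite_boundary s (aiC aX).
have main (X' Y' : set G) (KK LL : seq G) c :
    (forall x g, g \in s -> Y' x -> ~ Y' (x * g) -> x \in KK) ->
    (forall x g, g \in s -> X' x -> ~ X' (x * g) -> x \in LL) ->
    (forall p, p \in KK -> ~ translate c X' p) ->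
    (forall p, p \in LL -> ~ translate c^-1 Y' p) ->
    corner (translate c X') Y'.
  move=> hKK hLL nK nL.
  case: (pselect (exists x, (translate c X' `&` Y') x)) => [ex|nex]; last first.
    by apply: Or41; rewrite -subset0 => x xx; apply: nex; exists x.
  have e : translate c X' `&` Y' = setT.
    apply: gens => // x g gs [X'x Y'x]; split; apply: contrapT => nn.
      have lL : c^-1 * x \in LL.
        by apply: hLL gs _ _ => // => h; apply: nn; rewrite translateE mulgA.
      by apply: (nL _ lL); rewrite /translate /= invgK mulVKg.
    exact: nK (hKK _ _ gs Y'x nn) X'x.
  by apply: Or44; apply/seteqP; split => // x _; left;
    have [] : (translate c X' `&` Y') x by rewrite e.
apply: ae_mp (ae_unsplit (K ++ K') aX) _.
apply: ae_mp (ae_inv (ae_unsplit (L ++ L') aY)) _.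
apply: aeW => c hl hk.
have trC Z g : translate g (~` Z) = ~` translate g Z by [].
have nnC Z g p : translate g Z p -> ~ translate g (~` Z) p by move=> ? ; apply.
case: hk => hk; case: hl => hl.
- apply: cornerCE; apply: corner_sym; apply: cornerCE; apply: corner_sym; rewrite -trC.
  apply: (main _ _ K' L') => // p pk; apply: nnC.
    by apply: hk; rewrite mem_cat pk orbT.
  by apply: hl; rewrite mem_cat pk orbT.
- apply: cornerCE; rewrite -trC; apply: (main _ _ K L') => // p pk.
    by apply: nnC; apply: hk; rewrite mem_cat pk.
  by apply: hl; rewrite mem_cat pk orbT.
- apply: corner_sym; apply: cornerCE; apply: corner_sym.
  apply: (main _ _ K' L) => // p pk; last by apply: nnC; apply: hl; rewrite mem_cat pk.
  by apply: hk; rewrite mem_cat pk orbT.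
- apply: (main _ _ K L) => // p pk; last by apply: hl; rewrite mem_cat pk.
  by apply: hk; rewrite mem_cat pk.
Qed.

End Group.

(** * Ping-pong, and elements lying in an almost invariant set with their inverses *)

Section PingPong.
Context {G : groupType}.
Implicit Types (X Y Z B D P : set G) (c g h x y z : G).
Hypothesis fg : finitely_generated G.

(** The points [g * a], [g * b] and [b'] inhabit three of the four corners of [g X] and [Y], so
    nestedness leaves only that [g X] and [Y] cover the group. *)
Lemma ping_pong X Y a b b' : almost_invariant X -> almost_invariant Y -> X a -> ~ X b ->
  ~ Y b' ->
  almost_all (fun g => Y g -> X g^-1 -> translate g (~` X) `<=` Y).
Proof.
move=> aX aY Xa Xb Yb'.
apply: ae_mp (nested fg aX aY) _; apply: ae_mp (aY a) _; apply: ae_mp (aY b) _.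
apply: aeS (ae_inv (aX b')) => g hb' hb ha hc Yg Xg.
case: hc => hc.
- by case: (setI_disjoint hc (x := g * a)); [rewrite translate_mul|exact: ha].
- by case: Yb'; apply: hc; exact: hb'.
- by case: Xb; have := hc _ (hb Yg); rewrite translate_mul.
- by move=> x nX; apply: (setU_cover hc); exact: nX.
Qed.

(* If [P] contained almost no pair of inverses, then [G] would fix an end: almost
   all of [P] is a semigroup [M], containing a free one on two generators, in which
   the divisors of an element form almost a chain.  As the relation "[y] is an
   [n]-th ancestor of [x]" is invariant, an element has as many [n]-th descendants
   as [n]-th ancestors, which exponential growth of [M] contradicts. *)
Section MassTransport.
Variables P P1 P2 : set G.
Hypotheses (aP : almost_invariant P).
Hypotheses (aP1 : almost_invariant P1) (aP2 : almost_invariant P2).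
Hypotheses (iP1 : infinite_set P1) (iP2 : infinite_set P2).
Hypotheses (P1P : P1 `<=` P) (P2P : P2 `<=` P) (P12 : P1 `&` P2 = set0).
Hypothesis PV : finite_set [set g | P g /\ P g^-1].

Let M g := [/\ P g, translate g P `<=` P & translate g P <> P].

Let PV' : almost_all (fun g => P g -> ~ P g^-1).
Proof. by apply: aeS (proj1 (finite_ae _) PV) => g h ? ?; apply: h. Qed.

Let MM g h : M g -> M h -> M (g * h).
Proof.
move=> [Pg gP gnP] [Ph hP hnP]; split; rewrite -?translateM.
- by apply: gP; rewrite translate_mul.
- by move=> x /(translate_sub hP)/gP.
- by move=> e; apply: gnP; apply/seteqP; split => //; rewrite -{1}e; exact: translate_sub.
Qed.

Let M1 : ~ M 1.
Proof. by case=> _ _; rewrite translate1. Qed.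

Let ex_a : exists a, P a.
Proof. by have [x] := infinite_setN0 iP1; exists x; exact: P1P. Qed.

Let ex_b : exists b, ~ P b.
Proof. by have [x /P1P Px /(_ Px)] := ae_ex iP1 PV'; exists x^-1. Qed.

Let aeM : almost_all (fun g => translate g P `<=` P -> M g).
Proof.
have [[a Pa] [b Pb]] := (ex_a, ex_b).
apply: ae_mp (translate_neq aP Pa Pb) _;
  apply: aeS (almost_all_mulr_iff a aP) => g hg hn gP; split => //.
by apply/hg/gP; rewrite translate_mul.
Qed.

(** The quotients of elements of [P] that are incomparable for divisibility in [M]. Their finiteness
    makes the divisors of an element almost a chain. *)
Let E := [set g | (exists x, P x /\ P (g^-1 * x)) /\ ~ M g /\ ~ M g^-1].

(** Nestedness of [g P] and [P]: disjointness contradicts [x], an inclusion puts [g] or [g^-1] in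
    [M], and covering puts both in [P], for all but finitely many [g]. *)
Let fE : finite_set E.
Proof.
have [[a Pa] [b Pb]] := (ex_a, ex_b).
apply/finite_ae.
have hcov : almost_all (fun g => translate g P `|` P = setT -> P g).
  apply: aeS (almost_all_mulr_iff b aP) => g hg e; apply/hg.
  have : (translate g P `|` P) (g * b) by rewrite e.
  by case=> //; rewrite translate_mul.
have hcovV := ae_inv hcov; have aeMV := ae_inv aeM.
apply: ae_mp aeM _; apply: ae_mp aeMV _.
apply: ae_mp hcov _; apply: ae_mp hcovV _; apply: ae_mp PV' _.
apply: aeS (nested fg aP aP) => g hc hV hcV hc' hMV hM [[x [Px Pgx]] [nM nMV]].
case: hc => h.
- exact: setI_disjoint h Pgx Px.
- exact: nM (hM h).
- apply: nMV; apply: hMV => y; rewrite translateE invgK => /h.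
  by rewrite translate_mul.
- apply: hV (hc' h) _; apply: hcV.
  apply/seteqP; split => // y _; case: (pselect (P y)) => Py; [by right|left].
  by rewrite translateE invgK; apply: setU_cover h _; rewrite translate_mul.
Qed.

Let fac x := [set z | M z /\ M (z^-1 * x)].

Let ffac x : finite_set (fac x).
Proof.
apply/finite_ae; apply: ae_mp PV' _.
apply: aeS (ae_inv (aiP aP x)) => z hx hV [[/hV nP _ _] [PP _ _]].
by apply/nP/hx.
Qed.

Let l x := #|` fset_set (fac x)|%fset.
Let e := #|` fset_set E|%fset.

Let in_fac x z : z \in fset_set (fac x) -> fac x z.
Proof. by rewrite in_fset_set // inE. Qed.

Let fac_in x z : fac x z -> z \in fset_set (fac x).
Proof. by rewrite in_fset_set // inE. Qed.

Let l_lt m x : M m -> M x -> (l x < l (m * x))%N.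
Proof.
move=> Mm Mx.
have sub : ((m |` [fset m * z | z in fset_set (fac x)]) `<=` fset_set (fac (m * x)))%fset.
  apply/fsubsetP => z; rewrite !inE => /orP[/eqP->|/imfsetP[y /= /in_fac[My Myx] ->]];
    apply: fac_in; split => //.
  - by rewrite mulKg.
  - exact: MM.
  - by rewrite invgM -mulgA mulKg.
have := fsubset_leq_card sub; rewrite cardfsU1 card_imfset; last exact: mulgI.
have -> : m \notin [fset m * z | z in fset_set (fac x)]%fset.
  apply/negP => /imfsetP[y /= /in_fac[My _] h].
  by apply: M1; rewrite (_ : 1 = y) //; apply: (mulgI m); rewrite mulg1.
by [].
Qed.

(** For a divisor [z] of [g * x], the element [g^-1 * z] lies in [M], or its inverse does, or it
    lies in [E]. So [z] is [g] times a divisor of [x], a divisor of [g], or in [g E]. *)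
Let l_mul g x : M g -> M x -> (l (g * x) <= l x + (l g + e))%N.
Proof.
move=> Mg Mx.
have sub : (fset_set (fac (g * x)) `<=` [fset g * z | z in fset_set (fac x)] `|`
    (fset_set (fac g) `|` [fset g * z | z in fset_set E]))%fset.
  apply/fsubsetP => z /in_fac[Mz Mzx]; rewrite !in_fsetU.
  have [hE|nE] := pselect (E (g^-1 * z)).
    have -> : z \in [fset g * z | z in fset_set E]%fset.
      apply/imfsetP; exists (g^-1 * z); last by rewrite mulVKg.
      by rewrite /= in_fset_set // inE.
    by rewrite !orbT.
  have hx : exists y, P y /\ P ((g^-1 * z)^-1 * y).
    exists x; split; first by case: Mx.
    by rewrite invgM invgK -mulgA; case: Mzx.
  have [h|h] : M (g^-1 * z) \/ M (g^-1 * z)^-1.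
    by apply: contrapT => /not_orP h; apply: nE.
  - apply/orP; left; apply/imfsetP; exists (g^-1 * z); last by rewrite mulVKg.
    by apply: fac_in; split => //; rewrite invgM invgK -mulgA.
  - apply/orP; right; apply/orP; left; apply: fac_in; split => //.
    by rewrite invgM invgK in h.
apply: leq_trans (fsubset_leq_card sub) _.
apply: leq_trans (leq_card_fsetU _ _) _; rewrite card_imfset; last exact: mulgI.
rewrite leq_add2l; apply: leq_trans (leq_card_fsetU _ _) _.
by rewrite card_imfset //; exact: mulgI.
Qed.

(** For [x] and [y] of equal length, [x * y^-1] lies in [E]: were it or its inverse in [M], one of
    them would be longer by [l_lt]. So [A] lies in [E y]. *)
Let level n (A : {fset G}) : (forall x, x \in A -> M x /\ l x = n) -> (#|` A| <= e)%N.
Proof.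
move=> hA; have [->|[y yA]] := fset_0Vmem A; first by rewrite cardfs0.
have [My ly] := hA _ yA.
have sub : (A `<=` [fset z * y | z in fset_set E])%fset.
  apply/fsubsetP => x xA; have [Mx lx] := hA _ xA.
  apply/imfsetP; exists (x * y^-1); last by rewrite mulgVK.
  rewrite /= in_fset_set // inE; split.
    exists x; rewrite invgM invgK mulgVK; split; [by case: Mx|by case: My].
  have key u v : M v -> l u = n -> l v = n -> ~ M (u * v^-1).
    by move=> Mv lu lv h; have := l_lt h Mv; rewrite mulgVK lu lv ltnn.
  by split; [exact: key|rewrite invgM invgK; exact: key].
apply: leq_trans (fsubset_leq_card sub) _.
by rewrite card_imfset //; exact: mulIg.
Qed.

Let level_lt n (A : {fset G}) : (forall x, x \in A -> M x /\ (l x < n)%N) ->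
  (#|` A| <= n * e)%N.
Proof.
elim: n A => [|n IH] A hA.
  have [->|[y /hA[]//]] := fset_0Vmem A; by rewrite cardfs0.
rewrite -(cardfsID [fset x in A | l x == n]%fset A) mulSn leq_add //.
  apply: (@level n) => x; rewrite !inE => /andP[xA /andP[_ /eqP lx]].
  by have [] := hA _ xA.
apply: IH => x; rewrite !inE negb_and => /andP[nx xA]; move: nx; rewrite xA /= => nl.
have [Mx] := hA _ xA; rewrite ltnS leq_eqVlt (negPf nl); by [].
Qed.

Lemma no_inverse_free : False.
Proof.
have [[a Pa] [b Pb]] := (ex_a, ex_b).
(* Almost every element of [Q] has its inverse outside [P], so ping-pong against the complement of
   [P] pushes [P] into [Q]. *)
have step Q Q' : almost_invariant Q -> infinite_set Q -> Q `<=` P -> infinite_set Q' ->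
   Q' `<=` P -> Q `&` Q' = set0 -> exists2 g, M g & translate g P `<=` Q.
  move=> aQ iQ QP iQ' Q'P QQ'.
  have Qb : ~ Q b by move/QP.
  have nPa : ~ (~` P) a by apply.
  have [g Qg [hT hV]] := ae_ex iQ (aeI (ping_pong (aiC aP) aQ Pb nPa Qb) PV').
  have Pg := QP _ Qg.
  have gQ : translate g P `<=` Q by have := hT Qg (hV Pg); rewrite setCK.
  exists g => //; split => //; first by move=> x /gQ/QP.
  move=> h; have [x Q'x] := infinite_setN0 iQ'.
  by apply: (setI_disjoint QQ' (x := x)) => //; apply: gQ; rewrite h; exact: Q'P.
have [g Mg gP] := step _ _ aP1 iP1 P1P iP2 P2P P12.
have [h Mh hP] := step _ _ aP2 iP2 P2P iP1 P1P (etrans (setIC _ _) P12).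
pose C := (l g + e + (l h + e))%N.
(* Products of [k] letters [g] or [h] followed by [g]. They are distinct because [g P] and [h P] lie
   in the disjoint [P1] and [P2], and by [l_mul] each letter adds at most [C] to the length. *)
have grow k : exists2 A : {fset G}, #|` A| = (2 ^ k)%N &
   forall x, x \in A -> M x /\ (l x < k * C + (l g).+1)%N.
  elim: k => [|k [A cA hA]].
    exists [fset g]%fset; first by rewrite cardfs1.
    by move=> x; rewrite inE => /eqP ->.
  exists ([fset g * x | x in A] `|` [fset h * x | x in A])%fset.
    rewrite cardfsU (_ : (_ `&` _)%fset = fset0).
      by rewrite !card_imfset; [rewrite cA cardfs0 subn0 addnn -mul2n -expnS|exact:
        mulgI..].
    apply/fsetP => x; rewrite !inE; apply/negP => /andP[/imfsetP[y /= /hA[[Py _ _] _] ->]].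
    move=> /imfsetP[z /= /hA[[Pz _ _] _] eq].
    by apply: (setI_disjoint P12 (x := g * y)); [apply: gP;
      rewrite translate_mul|apply: hP; rewrite eq translate_mul].
  move=> x; rewrite in_fsetU => /orP[] /imfsetP[y /= /hA[My ly] ->]; split; try exact: MM.
    by apply: leq_ltn_trans (l_mul Mg My) _; rewrite mulSn {1}/C; lia.
  by apply: leq_ltn_trans (l_mul Mh My) _; rewrite mulSn {1}/C; lia.
have bound k : (2 ^ k <= k * (C * e) + (l g).+1 * e)%N.
  have [A <- hA] := grow k; apply: leq_trans (level_lt hA) _.
  by rewrite mulnDl mulnA.
have lin a' b' : exists k, (k * a' + b' < 2 ^ k)%N.
  (* With exponent 2m, 2^(2m) >= (m+1)^2 > 2m a' + b'. *)
  exists (2 * (2 * a' + b'))%N; set m := (2 * a' + b')%N.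
  have : (m.+1 * m.+1 <= 2 ^ m * 2 ^ m)%N by rewrite leq_mul // ltn_expl.
  rewrite -expnD addnn -mul2n; apply: leq_trans.
  have -> : (m.+1 * m.+1 = 2 * m * a' + b' + 1 + (m * b' + 2 * m - b'))%N by rewrite /m;
    nia.
  by rewrite addn1 leq_addr.
have [k] := lin (C * e)%N ((l g).+1 * e)%N.
by rewrite ltnNge bound.
Qed.
End MassTransport.
End PingPong.

Lemma card_gtII T (A : set T) k : ~~ (A #<= `I_k)%card -> (`I_k.+1 #<= A)%card.
Proof.
move=> nA; have [/finite_setP[n An]|/infiniteP h] := pselect (finite_set A); last first.
  by apply: card_le_trans h; exact: card_leT.
rewrite (card_le_eql An) card_le_II -ltnNge in nA.
by rewrite (card_le_eqr An) card_le_II.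
Qed.

(** * Ends *)

Section Components.
Variables (T : choiceType) (e : rel T) (V : set T).
Hypothesis es : symmetric e.
Let r := [rel u v | [&& u \in V, v \in V & e u v]].

Lemma component_disjoint x x' y : component e V x y -> component e V x' y ->
  component e V x = component e V x'.
Proof.
have rs : symmetric r by move=> u v /=; rewrite es andbCA.
have rev_path p u : path r u p -> exists2 q, path r (last u p) q & last (last u p) q = u.
  move=> pq; exists (rev (belast u p)).
    rewrite rev_path (eq_path (e' := r)) // => a b; exact: rs.
  by case: p {pq} => //= a p; rewrite rev_cons last_rcons.
have sub u u' z : component e V u z -> component e V u' z ->
  component e V u `<=` component e V u'.
  move=> [p pp ->] [p' pp' e'] w [q qq ->].
  have [p1 pp1 l1] := rev_path _ _ pp.
  exists (p' ++ p1 ++ q); first by rewrite !cat_path pp' -e' pp1 l1.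
  by rewrite !last_cat -e' l1.
by move=> h h'; apply/seteqP; split; apply: (sub _ _ y).
Qed.

Lemma component_sub x : V x -> component e V x `<=` V.
Proof.
move=> Vx y [p pp ->]; elim/last_ind: p pp => // p z _.
by rewrite rcons_path last_rcons => /andP[_ /and3P[_ /set_mem]].
Qed.

Lemma component_step x y z : V x -> component e V x y -> e y z -> V z -> component e V x z.
Proof.
move=> Vx Cy eyz Vz; have Vy := component_sub Vx Cy.
case: Cy => p pp ey; exists (rcons p z); last by rewrite last_rcons.
by rewrite rcons_path pp -ey /= eyz !mem_set.
Qed.

End Components.

Section Ends.
Context {G : groupType}.

(** An edge leaves a component only by entering [F], so a generator or its inverse moves only
    finitely many points out of it. Elements with this property form a subgroup. *)
Lemma component_ai (S F : set G) x : subgroup_generated S = setT -> finite_set F ->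
  ([set: G] `\` F) x -> almost_invariant (component (cayley S) ([set: G] `\` F) x).
Proof.
move=> gS /finite_ae fF Vx; set C := component _ _ _.
pose H : set G := [set g | almost_all (fun x => C x ->
  C (x * g)) /\ almost_all (fun x => C x -> C (x * g^-1))].
suff h : forall g, H g by move=> g; case: (h g).
apply: subgroup_generated_ind gS _ _ _.
- by rewrite /H /= invg1; split; apply: aeW => y; rewrite mulg1.
- move=> g h [g1 g2] [h1 h2]; split.
    by apply: ae_mp g1 _; apply: aeS (ae_mulr g h2) => y; rewrite mulgA => k1 k2 /k2/k1.
  by apply: ae_mp h1 _; apply: aeS (ae_mulr h g2) => y; rewrite invgF mulgA => k1 k2 /k2/k1.
- move=> s Ss; split.
    apply: aeS (ae_mulr s fF) => y ny Cy; apply: component_step Cy _ _ => //.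
    by rewrite /cayley /= mulKg mem_set.
  apply: aeS (ae_mulr s^-1 fF) => y ny Cy; apply: component_step Cy _ _ => //.
  by apply/orP; right; rewrite invgM invgK mulgVK mem_set.
Qed.

(** Failure of the bound [k] yields [k.+1] components, hence indices up to [k] inclusive. *)
Lemma many_ends k : infinitely_many_ends G -> finitely_generated G /\
  exists C : nat -> set G, (forall i, (i <= k)%N ->
    almost_invariant (C i) /\ infinite_set (C i)) /\
   (forall i j, (i <= k)%N -> (j <= k)%N -> i <> j -> C i `&` C j = set0).
Proof.
case=> S [fS gS]; rewrite /cayley_ends; case: pselect => // nb _.
split; first by exists S.
have : ~ ends_ubound [set: G] S k by move=> h; apply: nb; exists k; apply/asboolP.
move=> /existsNP[F] /not_implyP[fF] /not_implyP[_] /negP /card_gtII /pcard_leP[f].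
have inA i : (i <= k)%N -> infinite_components (cayley S) ([set: G] `\` F) (f i).
  by move=> ik; apply: funS.
exists f; split.
  by move=> i /inA[[x Vx ->] ?]; split => //; exact: component_ai.
move=> i j ik jk nij; rewrite -subset0 => y [].
have [[x Vx ex] _] := inA _ ik; have [[x' Vx' ex'] _] := inA _ jk.
rewrite ex ex' => h h'; apply: nij.
have : f i = f j.
  rewrite ex ex'; apply: component_disjoint h h'.
  by move=> u v; rewrite /cayley /= orbC.
by apply: (inj (f := f)); rewrite inE.
Qed.

End Ends.

Lemma finite_minimal (T : eqType) (A : set T) (R : T -> T -> Prop) :
  (forall x y z, R x y -> R y z -> R x z) -> finite_set A -> A !=set0 ->
  exists2 m, A m & forall x, A x -> R x m -> R m x.
Proof.
move=> Rt /finite_seqP[s ->] [x0 x0s].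
have {x0 x0s} : s != [::] by case: s x0s.
elim: s => // a s IH _; have [->|/IH[m ms hm]] := eqVneq s [::].
  by exists a; rewrite /= ?mem_seq1 // => x /=; rewrite mem_seq1 => /eqP->.
have [Ram|nRam] := pselect (R a m); last first.
  exists m => /=; first by rewrite in_cons ms orbT.
  by move=> x /=; rewrite in_cons => /orP[/eqP->//|xs]; exact: hm.
have [Rma|nRma] := pselect (R m a).
  exists m => /=; first by rewrite in_cons ms orbT.
  by move=> x /=; rewrite in_cons => /orP[/eqP->//|xs]; exact: hm.
exists a => /=; first by rewrite mem_head.
move=> x /=; rewrite in_cons => /orP[/eqP->//|xs] Rxa.
by apply: (Rt _ _ _ Ram); apply: hm => //; exact: Rt Rxa Ram.
Qed.

(** * Universal annuli *)

Section AlmostInclusion.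
Context {G : groupType}.
Implicit Types (X Y Z : set G) (c x : G).

Definition almost_sub X Y := almost_all (fun x => X x -> Y x).

Lemma sub_asub X Y : X `<=` Y -> almost_sub X Y.
Proof. by move=> h; apply: aeW. Qed.

Lemma asub_trans X Y Z : almost_sub X Y -> almost_sub Y Z -> almost_sub X Z.
Proof. by move=> h1 h2; apply: ae_mp h1 _; apply: aeS h2 => x h2 h1 /h1/h2. Qed.

Lemma asub_translate c X Y : almost_sub X Y -> almost_sub (translate c X) (translate c Y).
Proof. by move=> h; apply: aeS (ae_mull c^-1 h). Qed.

Lemma finite_asub X Y : finite_set (X `&` Y) <-> almost_sub X (~` Y).
Proof.
split=> [/finite_ae|h]; last first.
  by apply/finite_ae; apply: aeS h => x h [/h].
by apply: aeS => x h Xx Yx; apply: h.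
Qed.

Lemma infinite_asub X Y : infinite_set X -> almost_sub X Y -> infinite_set Y.
Proof.
move=> iX h /finite_ae fY; apply: iX; apply/finite_ae; apply: ae_mp fY _.
by apply: aeS h => x h nY /h.
Qed.

Lemma infinite_sub X Y : infinite_set X -> X `<=` Y -> infinite_set Y.
Proof. by move=> iX h; apply: infinite_asub iX (sub_asub h). Qed.

Lemma infinite_translate c {X} : infinite_set X -> infinite_set (translate c X).
Proof.
move=> iX h; apply: iX; apply: sub_finite_set (_ :
  _ `<=` ( *%g c^-1) @` translate c X) (finite_image _ h).
by move=> x Xx; exists (c * x); rewrite ?translate_mul // mulKg.
Qed.

End AlmostInclusion.
Arguments infinite_translate {G} c {X}.

(** * Turns of a cut, and the annulus that realises all of them *)

Section Turns.
Context {G : groupType}.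
Implicit Types (X Y D : set G) (c g h x y : G).
Hypothesis fg : finitely_generated G.

(** [J] becomes connected once the quotients of its boundary points are added to the generators: if
    neither [Y] nor its complement in [J] is everything, each contains a boundary point of [J] or an
    exit by a generator exists. *)
Lemma ai_connected (J : set G) : almost_invariant J -> exists s : seq G, 1 \in s /\
  forall Y, Y `<=` J -> Y !=set0 -> J `\` Y !=set0 ->
   exists h f, [/\ Y h, f \in s, J (h * f) & ~ Y (h * f)].
Proof.
move=> aJ; have [s0 sV gens] := fg_closed fg.
have [K hK] := finite_boundary s0 aJ.
exists (1 :: s0 ++ [seq a^-1 * b | a <- K, b <- K]); split; first by rewrite mem_head.
move=> Y YJ Y0 [z [Jz nYz]]; apply: contrapT => nex.
have cl h f : Y h -> (f \in s0) || (f \in [seq a^-1 * b | a <- K, b <- K]) ->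
  J (h * f) -> Y (h * f).
  move=> Yh fs Jhf; apply: contrapT => nY; apply: nex; exists h, f; split => //.
  by rewrite in_cons mem_cat fs orbT.
have [a [Ya aK]] : exists a, Y a /\ a \in K.
  apply: contrapT => na.
  have YT : Y = setT.
    apply: gens => // x g gs Yx; apply: cl; rewrite ?gs //.
    by apply: contrapT => nJ; apply: na; exists x; split => //; exact: hK gs (YJ _ Yx) nJ.
  by apply: nYz; rewrite YT.
have [b [Jb nYb bK]] : exists b, [/\ J b, ~ Y b & b \in K].
  apply: contrapT => nb.
  have JYT : J `\` Y = setT.
    apply: gens; first by exists z.
    move=> x g gs [Jx nYx].
    have Jxg : J (x * g) by apply: contrapT => nJ; apply: nb; exists x; split => //;
      exact: hK gs Jx nJ.
    split => // Yxg; apply: nYx; rewrite -(mulgK g x); apply: cl; rewrite ?sV ?mulgK //.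
  by have [w Yw] := Y0; have [] : (J `\` Y) w by rewrite JYT.
apply: nYb; rewrite -(mulVKg a b); apply: cl; rewrite ?mulVKg //.
by apply/orP; right; apply/allpairsP; exists (a, b).
Qed.

(** The infinite difference is what makes the translates found in successive annuli of a chain
    distinct. *)
Definition universal B W := forall D,
  almost_invariant D -> infinite_set D -> infinite_set (~` D) ->
  exists z, [/\ almost_sub B (translate z D), almost_sub (translate z D) (translate W B)
    & infinite_set (translate W B `\` translate z D)].

Section Halfspace.
Variables (B : set G) (e y b p : G).
Hypotheses (aB : almost_invariant B) (Bb : B b) (eB : translate e B `<=` ~` B) (Bp :
  ~ B p) (eBp : ~ translate e B p).

(** Both [g B] and [g e B] meet [D], at [g * b] and [g * (e * b)]. If neither lay in [D], each would
    contain [D] or its complement. The same one for both contradicts disjointness; different ones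
    would cover the group, but [g * p] is in neither. *)
Lemma deep_translate D : almost_invariant D -> almost_all (fun g => D g ->
  translate g B `<=` D \/ translate (g * e) B `<=` D).
Proof.
move=> aD; have [[q Dq]|nD] := pselect (exists q, ~ D q); last first.
  by apply: aeW => g _; left => x _; apply: contrapT => nx; apply: nD; exists x.
apply: ae_mp (nested fg aB aD) _; apply: ae_mp (ae_mulr e (nested fg aB aD)) _.
apply: ae_mp (aD b) _; apply: aeS (aD (e * b)) => g he hb hce hc Dg.
have Dgb := hb Dg; have Dgeb := he Dg.
have ebE : translate (g * e) B (g * (e * b)) by rewrite mulgA translate_mul.
have gbE : translate g B (g * b) by rewrite translate_mul.
case: hc => hc; [by case: (setI_disjoint hc gbE)|by left| |];
  case: hce => hce; try (by case: (setI_disjoint hce ebE)); try by right.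
- by have := hce _ Dgb; rewrite -translateM translate_mul => /eB.
- by case: eBp; rewrite -(translate_mul g) translateM;
  apply: contrapT => /(setU_cover hce)/hc; rewrite translate_mul.
- case: eBp; rewrite -(translate_mul g) translateM; apply: hce; apply: (setU_cover hc).
  by rewrite translate_mul.
- case: (pselect (translate g B q)) => [gq|/(setU_cover hc)//].
  case: (pselect (translate (g * e) B q)) => [|/(setU_cover hce)//].
  by rewrite -translateM => /eB.
Qed.

Lemma deep_translate_ex D : almost_invariant D -> infinite_set D ->
  exists u, translate u B `<=` D.
Proof.
by move=> aD iD; have [g Dg /(_ Dg)[?|?]] := ae_ex iD (deep_translate aD);
  [exists g|exists (g * e)].
Qed.

Hypotheses (yB : translate y (~` B) `<=` B) (iyB : infinite_set (B `\` translate y (~` B))).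

Let turned D g f := finite_set (translate g B `&` ~` D) /\ finite_set (translate (g * f)
  B `&` D).

Let psub X Y := X `<=` Y /\ X <> Y.

(** The set [J] of positions of proper subtranslates of [B] is almost [B], hence connected under a
    finite set of steps independent of [D]. No such subtranslate is split by [D], so some step
    passes from one almost inside [D] to one almost outside. *)
Lemma find_turn : exists R : seq G, forall D, almost_invariant D ->
  infinite_set (B `&` D) -> infinite_set (B `&` ~` D) ->
  (forall h, psub (translate h B) B ->
    finite_set (translate h B `&` D) \/ finite_set (translate h B `&` ~` D)) ->
  exists g f, f \in R /\ turned D g f.
Proof.
pose u (i : bool) : G := if i then e else 1.
pose J : set G := [set h | exists i, psub (translate (h * u i) B) B].
have aJ : almost_invariant J.
  apply: ai_ae aB _.
  have hn := translate_neq_self aB Bb Bp.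
  apply: ae_mp (deep_translate aB) _; apply: ae_mp (ae_mulr e hn) _; apply: ae_mp hn _.
  apply: ae_mp (almost_all_mulr_iff b aB) _;
    apply: aeS (almost_all_mulr_iff (e * b) aB) => h heb hb n1 ne hd; split.
    by move=> /hd[?|?]; [exists false; rewrite mulg1|exists true].
  by case=> -[] [hB _]; [apply/heb|apply/hb]; apply: hB;
    rewrite /u ?mulgA ?mulg1 translate_mul.
have [s [s1 conn]] := ai_connected aJ.
pose R := [seq (u ij.1)^-1 * f * u ij.2 |
  ij <- [seq (i, j) | i <- [:: true; false], j <- [:: true; false]], f <- s].
exists R.
move=> D aD iD iD' hmin.
have found i j h f : f \in s -> finite_set (translate (h * u i) B `&` ~` D) ->
    finite_set (translate (h * f * u j) B `&` D) -> exists g f, f \in R /\ turned D g f.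
  move=> fs h1 h2; exists (h * u i), ((u i)^-1 * f * u j); split.
    by apply/allpairsP; exists ((i, j), f); split=> //=; case: i {h1}; case: j {h2}.
  by split => //; rewrite !mulgA mulgK.
have dp Q : almost_invariant Q -> infinite_set Q -> Q `<=` B -> B `\` Q !=set0 ->
    exists h i, translate (h * u i) B `<=` Q /\ psub (translate (h * u i) B) B.
  move=> aQ iQ QB [w [Bw nQw]].
  have [h Qh /(_ Qh) hd] := ae_ex iQ (deep_translate aQ).
  have [i hi] : exists i, translate (h * u i) B `<=` Q.
    by case: hd => hd; [exists false; rewrite mulg1|exists true].
  exists h, i; split => //; split; first by move=> x /hi/QB.
  by move=> E; apply: nQw; apply: hi; rewrite E.
pose Y : set G := [set h | exists i,
  psub (translate (h * u i) B) B /\ finite_set (translate (h * u i) B `&` ~` D)].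
have YJ : Y `<=` J by move=> h [i [? _]]; exists i.
have [w BDw] := infinite_setN0 iD; have [w' BDw'] := infinite_setN0 iD'.
have n1 : B `\` (B `&` D) !=set0 by exists w'; case: BDw' => ? nD; split => // -[].
have n2 : B `\` (B `&` ~` D) !=set0 by exists w; case: BDw => ? ?; split => // -[_]; apply.
have [h [i [hi pi]]] := dp _ (aiI aB aD) iD (@subIsetl _ _ _) n1.
have Y0 : Y !=set0.
  exists h, i; split => //; rewrite (_ : _ `&` _ = set0) // -subset0 => x [/hi[_ Dx]].
  exact.
have [h' [i' [hi' pi']]] := dp _ (aiI aB (aiC aD)) iD' (@subIsetl _ _ _) n2.
have fD' : finite_set (translate (h' * u i') B `&` D).
  by rewrite (_ : _ `&` _ = set0) // -subset0 => x [/hi'[_]].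
(* If [h'] carries translates on both sides of [D], the turn is made on the spot, with step [1]. *)
have [Yh'|nYh'] := pselect (Y h').
  case: Yh' => j [pj fj]; apply: (found j i' h' 1) => //; by rewrite mulg1.
have [k [f [[j [pj fj]] fs [j' pj'] nY]]] := conn Y YJ Y0 (ex_intro _ h' (conj (ex_intro
  _ i' pi') nYh')).
apply: (found j j' k f) => //; case: (hmin _ pj') => // h3.
by case: nY; exists j'.
Qed.

(** Almost every [g B] is nested with [D]; if split by [D], it then contains [D] or its complement,
    which for almost all [g] forces [g0 * p] into it. So only finitely many split translates lie in
    [g0 B], and a minimal one exists. *)
Lemma minimal_split D : almost_invariant D -> infinite_set D -> infinite_set (~` D) ->
  exists g, [/\ infinite_set (translate g B `&` D), infinite_set (translate g B `&` ~` D) &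
   forall h, translate h B `<=` translate g B -> translate h B <> translate g B ->
     finite_set (translate h B `&` D) \/ finite_set (translate h B `&` ~` D)].
Proof.
move=> aD iD iD'.
pose Sp g := infinite_set (translate g B `&` D) /\ infinite_set (translate g B `&` ~` D).
have [g0 Sp0] : exists g0, Sp g0.
  have [w hw] := deep_translate_ex aD iD.
  (* As [w B] lies in [D] and [w y] maps the complement of [B] into [w B], the translate [w y B]
     contains the complement of [D] and an infinite part of [D]. *)
  exists (w * y).
  have sub : translate (w * y) (~` B) `<=` translate w B by rewrite -translateM;
    exact: translate_sub.
  split.
    apply: infinite_sub (infinite_translate w iyB) _ => x [Bx nx]; split; last exact: hw.
    by rewrite -translateM; apply: contrapT.
  apply: infinite_sub iD' _ => x nDx; split => //; apply: contrapT => nx.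
  by apply: nDx; apply/hw/sub.
have iB : infinite_set B by apply: infinite_sub iyB _ => x [].
have fin : finite_set [set g | Sp g /\ translate g B `<=` translate g0 B].
  have [[d Dd] [d' Dd']] := (infinite_setN0 iD, infinite_setN0 iD').
  apply/finite_ae; apply: ae_mp (ae_unsep d (g0 * p) aB) _.
  apply: ae_mp (ae_unsep d' (g0 * p) aB) _.
  apply: aeS (nested fg aB aD) => g hc h' h [[S1 S2] gg0].
  have np : ~ translate g B (g0 * p) by move=> /gg0; rewrite translate_mul.
  case: hc => hc.
  - by case: S1; rewrite hc.
  - case: S2; rewrite (_ : _ `&` _ = set0) // -subset0 => x [/hc ? ]; exact.
  - by apply/np/h/hc.
  - apply/np/h'; have := setU_cover (etrans (setUC _ _) hc) Dd'; exact.
have [||g [Sg gg0] gmin] := finite_minimal (R := fun g h => translate g B `<=` translate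
  h B) _ fin.
- by move=> g1 g2 g3; exact: subset_trans.
- by exists g0; split.
exists g; case: (Sg) => S1 S2; split=> // h hg nhg; apply: contrapT => /not_orP[f1 f2].
apply: nhg; apply/seteqP; split => //; apply: gmin => //.
by split => // x /hg/gg0.
Qed.

(* The annulus between [B] and [W B] contains a representative of every possible
   turn, so every cut of the group has a translate running through it. *)
Lemma universal_annulus : exists W, universal B W.
Proof.
have [R hR] := find_turn.
pose L := [seq f <- R | `[< finite_set (B `&` translate f B) >]].
(* One factor [f * y] per admissible turn: [B] lies almost in [f] applied to its complement, which
   lies in [f y B]. So every factor moves [B] outwards. *)
pose w (s : seq G) := foldr (fun f v => f * y * v) 1 s.
have cyB : ~` B `<=` translate y B.
  by move=> x nBx; apply: contrapT => nx; apply: nBx; apply: yB.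
have wB s : {subset s <= L} -> almost_sub B (translate (w s) B).
  elim: s => [_|f s IH sL] /=; first by rewrite translate1; exact: sub_asub.
  have : f \in L by apply: sL; rewrite mem_head.
  rewrite mem_filter => /andP[/asboolP /finite_asub hf _].
  apply: (@asub_trans _ _ (translate (f * y) B)).
    by apply: asub_trans hf _; apply: sub_asub; rewrite -translateM;
      exact: (translate_sub cyB).
  by rewrite -translateM; apply: asub_translate; apply: IH => g gs; apply: sL;
    rewrite in_cons gs orbT.
(* An extra factor making the outer inclusion strict by an infinite set. *)
pose v := e * y.
have vB : B `<=` translate v B.
  move=> x Bx; rewrite -translateM; apply: (translate_sub cyB) => ebx; exact: (eB ebx).
have ivB : infinite_set (translate v B `\` B).
  apply: infinite_sub (infinite_translate e iyB) _ => x [Bx nx]; split; last exact: eB.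
  by rewrite -translateM; apply: contrapT.
exists (w L * v) => D aD iD iD'.
have [g [i1 i2 hmin]] := minimal_split aD iD iD'.
have trI c X Y : translate c (X `&` Y) = translate c X `&` translate c Y by [].
have trC c X : translate c (~` X) = ~` translate c X by [].
have trg Q : infinite_set (translate g B `&` Q) -> infinite_set (B `&` translate g^-1 Q).
  by move=> /(infinite_translate g^-1); rewrite trI translateM mulVg translate1.
have trf h Q : finite_set (translate (g * h) B `&` Q) ->
  finite_set (translate h B `&` translate g^-1 Q).
  move=> hf; apply: contrapT => /(infinite_translate g); apply.
  by rewrite trI !translateM mulgV translate1.
have [|k [f [fR [t1 t2]]]] := hR _ (ai_translate g^-1 aD) (trg _ i1) (trg _ i2).
  move=> h [hB nhB]; have [| |h1|h1] := hmin (g * h).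
  - by rewrite -translateM; exact: translate_sub.
  - by move=> /(congr1 (translate g^-1)); rewrite !translateM mulKg mulVg translate1.
  - by left; exact: trf.
  - by right; rewrite -trC; exact: trf.
pose D' := translate (g * k)^-1 D.
have D'E : translate k^-1 (translate g^-1 D) = D' by rewrite translateM -invgM.
have bD' : almost_sub B D'.
  move/finite_asub: t1 => /(asub_translate k^-1);
    rewrite translateM mulVg translate1 trC trC setCK.
  by rewrite D'E.
have fD' : almost_sub D' (translate f (~` B)).
  rewrite setIC in t2; move/finite_asub: t2 => /(asub_translate k^-1).
  by rewrite D'E -trC translateM mulKg.
have fL : f \in L.
  rewrite mem_filter fR andbT; apply/asboolP/finite_asub.
  exact: asub_trans bD' fD'.
(* The product is cut at the turn [f] made by [D]: [w L1] carries [D'] to the required place, and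
   the factor [f * y] followed by [w L2] leaves room above it. *)
have [L1 [L2 EL]] : exists L1 L2, L = L1 ++ f :: L2.
  by case/splitPr: fL => L1 L2; exists L1, L2.
have wE : w L = w L1 * (f * y * w L2).
  by rewrite EL; elim: L1 {EL} => [|a s IH] /=; rewrite ?mul1g // IH !mulgA.
have sub1 : {subset L1 <= L} by move=> x; rewrite EL mem_cat => ->.
have sub2 : {subset L2 <= L} by move=> x; rewrite EL mem_cat in_cons => ->; rewrite !orbT.
have zW : almost_sub (translate (w L1) D') (translate (w L) B).
  rewrite wE -translateM; apply: asub_translate; apply: asub_trans fD' _.
  apply: (@asub_trans _ _ (translate (f * y) B)).
    by apply: sub_asub; rewrite -translateM; exact: (translate_sub cyB).
  by rewrite -[translate (f * y * _) _]translateM; apply: asub_translate; exact: wB.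
have WW : almost_sub (translate (w L) B) (translate (w L * v) B).
  by rewrite -translateM; apply: sub_asub; exact: translate_sub.
exists (w L1 * (g * k)^-1); rewrite -translateM; split.
- by apply: asub_trans (wB _ sub1) _; exact: asub_translate.
- exact: asub_trans zW WW.
- apply: infinite_asub (infinite_translate (w L) ivB) _.
  by apply: aeS zW => x h [h1 h2]; split; [rewrite -translateM|move/h].
Qed.

End Halfspace.
End Turns.

(** * Medians of three ends *)

Section Existence.
Context {G : groupType}.
Implicit Types (X Y Z B D P : set G) (c g h x y z : G).

(** [e] moves [B] off itself with room to spare at [p], and [y] moves the complement of [B] deep
    into [B]. *)
Definition halfspace B e y b p := [/\ almost_invariant B, B b, translate e B `<=` ~` B,
  ~ B p & ~ translate e B p] /\
  (translate y (~` B) `<=` B /\ infinite_set (B `\` translate y (~` B))).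

Definition tripartition (X : 'I_3 -> set G) :=
  [/\ forall i, almost_invariant (X i), forall i, infinite_set (X i),
      forall i j, i <> j -> X i `&` X j = set0 & forall x, exists i, X i x].

Lemma aiU X Y : almost_invariant X -> almost_invariant Y -> almost_invariant (X `|` Y).
Proof.
move=> aX aY g; apply: ae_mp (aX g) _; apply: aeS (aY g) => x h1 h2 [?|?].
  by left; apply: h2.
by right; apply: h1.
Qed.

Lemma tripartition_ex : infinitely_many_ends G -> exists X : 'I_3 -> set G, tripartition X.
Proof.
move=> /(many_ends 2)[_ [C [CP Cd]]].
pose X (i : 'I_3) := if i == 0%N :> nat then C 0%N else if i == 1%N :> nat then C 1%N
  else ~` (C 0%N `|` C 1%N).
have [[a0 i0] [a1 i1] [a2 i2]] := And3 (CP 0%N isT) (CP 1%N isT) (CP 2%N isT).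
have d01 : C 0%N `&` C 1%N = set0 by apply: Cd.
have d02 : C 0%N `&` C 2%N = set0 by apply: Cd.
have d12 : C 1%N `&` C 2%N = set0 by apply: Cd.
exists X; split.
- by move=> [[|[|[|i]]] hi] //=; apply/aiC/aiU.
- move=> [[|[|[|i]]] hi] //=; apply: infinite_sub i2 _ => x x2 [x0|x1].
    exact: setI_disjoint d02 x0 x2.
  exact: setI_disjoint d12 x1 x2.
- move=> [[|[|[|i]]] hi] // [[|[|[|j]]] hj] // nij; rewrite /X /= ?d01 //;
    try (by case: nij; exact: val_inj); rewrite -subset0 => x [].
  + by move=> x0; case; left.
  + by move=> x1 x0; exact: setI_disjoint d01 x0 x1.
  + by move=> x1; case; right.
  + by move=> nx x0; case: nx; left.
  + by move=> nx x0; case: nx; right.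
- move=> x; have [x0|n0] := pselect (C 0%N x); first by exists (@Ordinal 3 0 isT).
  have [x1|n1] := pselect (C 1%N x); first by exists (@Ordinal 3 1 isT).
  by exists (@Ordinal 3 2 isT); rewrite /X /= => -[].
Qed.

(** [B] is the union of two of four disjoint pieces, so [no_inverse_free] applies to [B] and to its
    complement, and ping-pong gives [y0] and [e]. Composing [y0] with a [u] that puts [B] inside the
    piece [C 0] leaves the piece [C 1] as an infinite difference. *)
Lemma halfspace_ex : infinitely_many_ends G -> exists B e y b p, halfspace B e y b p.
Proof.
move=> /(many_ends 3)[fg [C [CP Cd]]].
have [a0 i0] := CP 0%N isT; have [a1 i1] := CP 1%N isT.
have [a2 i2] := CP 2%N isT; have [a3 i3] := CP 3%N isT.
have d (i j : nat) (x : G) : (i <= 3)%N -> (j <= 3)%N -> i <> j -> C i x -> C j x -> False.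
  by move=> i3' j3 ij; apply: setI_disjoint; exact: Cd.
pose B := C 0%N `|` C 1%N.
have aB : almost_invariant B by exact: aiU.
have B2 : C 2%N `<=` ~` B by move=> x x2 [x0|x1];
  [exact: (d 0%N 2%N x)|exact: (d 1%N 2%N x)].
have B3 : C 3%N `<=` ~` B by move=> x x2 [x0|x1];
  [exact: (d 0%N 3%N x)|exact: (d 1%N 3%N x)].
have B0 : C 0%N `<=` B by left.
have B1 : C 1%N `<=` B by right.
have [b Cb] := infinite_setN0 i0; have Bb := B0 _ Cb.
have [q Cq] := infinite_setN0 i2; have Bq : ~ B q by exact: B2.
have nBb : ~ (~` B) b by exact.
have iV : infinite_set [set g | B g /\ B g^-1].
  by move=> h; apply: (no_inverse_free fg aB a0 a1 i0 i1 B0 B1 _ h); exact: Cd.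
have iV' : infinite_set [set g | (~` B) g /\ (~` B) g^-1].
  by move=> h; apply: (no_inverse_free fg (aiC aB) a2 a3 i2 i3 B2 B3 _ h); exact: Cd.
have [y0 [By0 BV] /(_ By0 BV) hy0] := ae_ex iV (ping_pong fg aB aB Bb Bq Bq).
have [e [Be BeV] [/(_ Be BeV) he nhe]] := ae_ex iV'
  (aeI (ping_pong fg (aiC aB) (aiC aB) Bq nBb nBb) (translate_neq aB (Y := ~` B) Bq nBb)).
rewrite setCK in he.
have [p [Bp eBp]] : exists p, ~ B p /\ ~ translate e B p.
  apply: contrapT => np; apply: nhe; apply/seteqP; split => // x nBx.
  by apply: contrapT => nx; apply: np; exists x.
have [u uB] := deep_translate_ex fg aB Bb he Bp eBp a0 i0.
have yu : translate (u * y0) (~` B) `<=` C 0%N by rewrite -translateM => x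
  /(translate_sub hy0) /uB.
exists B, e, (u * y0), b, p; split; split => //; first by move=> x /yu /B0.
apply: infinite_sub i1 _ => x x1; split; first by right.
by move=> /yu x0; exact: (d 0%N 1%N x).
Qed.

End Existence.

Section Median.
Context {G : groupType}.
Implicit Types (Y Z B D P : set G) (c g h x y z : G).
Variables (X : 'I_3 -> set G) (XP : tripartition X).

(* The majority vote of three ends: a substitute for membership of a point which
   depends on [Z] only up to finite sets. *)
Definition median (U : 'I_3 -> set (set G)) Z := exists i j, [/\ i <> j, U i Z & U j Z].

(** Each [U i] contains every cofinite subset of [X i], so on almost invariant sets it represents an
    end of the group inside [X i]. *)
Definition ends_in (U : 'I_3 -> set (set G)) :=
  forall i, UltraFilter (U i) /\ forall Z, almost_sub (X i) Z -> U i Z.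

Lemma ends_in_ex : exists U, ends_in U.
Proof.
case: XP => _ iX _ _.
have h i : exists V, UltraFilter V /\ forall Z, almost_sub (X i) Z -> V Z.
  pose F : set (set G) := [set Z | almost_sub (X i) Z].
  have FF : ProperFilter F.
    split; first by move=> h; apply: (iX i); apply/finite_ae; exact: h.
    split.
    - by apply: sub_asub.
    - by move=> P Q hP hQ; apply: ae_mp hP _; apply: aeS hQ => x hq hp xx; split;
      [exact: hp|exact: hq].
    - by move=> P Q PQ hP; apply: asub_trans hP _; exact: sub_asub.
  by have [V [UV FV]] := ultraFilterLemma FF; exists V.
by have [V hV] := choice h; exists V.
Qed.

Variables (U : 'I_3 -> set (set G)) (UP : ends_in U).
Notation m := (median U).

Let U0 i : ~ U i set0.
Proof. by have [uf _] := UP i; exact: filter_not_empty. Qed.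

Let UI i Y Z : U i Y -> U i Z -> U i (Y `&` Z).
Proof. by have [uf _] := UP i; exact: filterI. Qed.

Let US i Y Z : almost_sub Y Z -> U i Y -> U i Z.
Proof.
have [uf h] := UP i => YZ UY.
have : U i (Y `&` [set x | Y x -> Z x]) by apply: UI => //; apply: h; apply: aeS YZ.
by apply: filterS => x [? +]; apply.
Qed.

Let UX i : U i (X i).
Proof. by have [_ h] := UP i; apply/h/sub_asub. Qed.

Let UXn i j : i <> j -> ~ U i (X j).
Proof. by case: XP => _ _ d _ ij /(UI (UX i)); rewrite d //; exact: U0. Qed.

Let third (i j : 'I_3) : i <> j -> exists k, forall l, [\/ l = i, l = j | l = k].
Proof.
move=> nij; have nij' : (i : nat) <> j by move=> h; apply: nij; exact: val_inj.
have ilt := ltn_ord i; have jlt := ltn_ord j.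
have klt : (3 - i - j < 3)%N by lia.
exists (Ordinal klt) => l; have llt := ltn_ord l.
have [li|li] := eqVneq (l : nat) i; first by apply: Or31; exact: val_inj.
have [lj|lj] := eqVneq (l : nat) j; first by apply: Or32; exact: val_inj.
by apply: Or33; apply: val_inj => /=; lia.
Qed.

Lemma median_mono Y Z : almost_sub Y Z -> m Y -> m Z.
Proof. by move=> YZ [i [j [ij Ui Uj]]]; exists i, j; split => //; exact: US YZ _. Qed.

Lemma medianC Z : ~ m Z -> m (~` Z).
Proof.
move=> nm; pose i0 := @Ordinal 3 0 isT; pose i1 := @Ordinal 3 1 isT;
  pose i2 := @Ordinal 3 2 isT.
have UC i : U i Z \/ U i (~` Z) by have [uf _] := UP i; exact: in_ultra_setVsetC.
have n01 : i0 <> i1 by move=> /(congr1 val).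
have n02 : i0 <> i2 by move=> /(congr1 val).
have n12 : i1 <> i2 by move=> /(congr1 val).
case: (UC i0) (UC i1) (UC i2) => h0 [] h1 [] h2;
  by [case: nm; exists i0, i1|case: nm; exists i0, i2|case: nm; exists i1, i2
     |exists i0, i1|exists i0, i2|exists i1, i2].
Qed.

(** If [i] and [j] vote for [Z], then [Z] is neither disjoint from [X i] nor inside it, so it
    contains [X i] or covers with it; likewise for [j]. If it contains both, the third piece
    completes it. *)
Lemma median_cover Z : (forall i, corner Z (X i)) -> m Z -> exists k, Z `|` X k = setT.
Proof.
case: XP => _ _ _ cov hc [i [j [ij Ui Uj]]].
have key i' j' : i' <> j' -> U i' Z -> U j' Z -> Z `|` X i' = setT \/ X i' `<=` Z.
  move=> ij' Ui' Uj'; case: (hc i') => h; [| |by right|by left].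
    by case: (U0 (i := i')); rewrite -h; apply: UI.
  by case: (UXn (nesym ij')); apply: US Uj'; exact: sub_asub.
have [?|Xi] := key _ _ ij Ui Uj; first by exists i.
have [?|Xj] := key _ _ (nesym ij) Uj Ui; first by exists j.
have [k hk] := third ij; exists k; apply/seteqP; split => // x _.
by have [l] := cov x; case: (hk l) => -> xl; [left; exact: Xi|left; exact: Xj|right].
Qed.

Lemma median_sub Z : (forall i, corner Z (X i)) -> ~ m Z -> exists k, Z `<=` X k.
Proof.
move=> hc /medianC h; have [i|k hk] := median_cover _ h; first exact: cornerC.
by exists k => x Zx; apply: (setU_cover hk); exact.
Qed.

(** If [u B] lies in one piece, at most one end votes for it, while [u y B] contains the other two
    pieces. *)
Lemma median_translate B e y b p : finitely_generated G -> halfspace B e y b p ->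
  (exists c, m (translate c B)) /\ (exists c, ~ m (translate c B)).
Proof.
move=> fg [[aB Bb eB Bp eBp] [yB _]]; case: XP => aX iX dX _.
pose i0 := @Ordinal 3 0 isT; pose i1 := @Ordinal 3 1 isT; pose i2 := @Ordinal 3 2 isT.
have [u uB] := deep_translate_ex fg aB Bb eB Bp eBp (aX i0) (iX i0).
split.
  exists (u * y); exists i1, i2.
  have h i : i <> i0 -> U i (translate (u * y) B).
    move=> ni; apply: US (UX i); apply: sub_asub => x xi; apply: contrapT => nx.
    apply: (setI_disjoint (dX i i0 ni) xi); apply: uB; apply: (translate_sub yB);
      by rewrite translateM.
  by split => //; exact: h.
exists u => -[i [j [ij Ui Uj]]].
have U0i k : U k (translate u B) -> k = i0.
  move=> Uk; apply: contrapT => nk; apply: (UXn nk); apply: US Uk; exact: sub_asub.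
by apply: ij; rewrite (U0i _ Ui) (U0i _ Uj).
Qed.

End Median.

(** * Chains of annuli *)

Section Affine.
Context {G : groupType}.
Implicit Types (Y Z B D P : set G) (c g h x y z : G) (a b : G -> G).

(* Compositions of automorphisms and translations, as the bijections preserving
   the heap operation. *)
Definition affine a := (exists2 a', cancel a a' & cancel a' a) /\
  forall x y z, a (x * y^-1 * z) = a x * (a y)^-1 * a z.

Lemma affine_id : affine id.
Proof. by split=> //; exists id. Qed.

Lemma affine_comp a b : affine a -> affine b -> affine (a \o b).
Proof.
move=> [[a' aK a'K] ha] [[b' bK b'K] hb]; split.
  by exists (b' \o a'); [exact: can_comp|exact: can_comp].
by move=> x y z /=; rewrite hb ha.
Qed.

Lemma affine_inv a a' : cancel a a' -> cancel a' a -> affine a -> affine a'.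
Proof.
move=> aK a'K [_ ha]; split; first by exists a.
by move=> x y z; apply: (can_inj aK); rewrite ha !a'K.
Qed.

Lemma affine_mul g : affine ( *%g g).
Proof.
split; first by exists ( *%g g^-1); [exact: mulKg|exact: mulVKg].
by move=> x y z; rewrite invgM !mulgA mulgVK.
Qed.

Lemma affine_iter a n : affine a -> affine (iter n a).
Proof. by move=> ha; elim: n => [|n IH]; [exact: affine_id|exact: (affine_comp ha IH)]. Qed.

Lemma affine_ai a Y : affine a -> almost_invariant Y -> almost_invariant (a @^-1` Y).
Proof.
move=> [[a' aK a'K] ha] aY g; apply: aeS (ae_can aK (aY ((a 1)^-1 * a g))) => x /=.
by rewrite mulgA -ha invg1 mulg1.
Qed.

Lemma affine_asub a Y Z : affine a -> almost_sub Y Z -> almost_sub (a @^-1` Y) (a @^-1` Z).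
Proof. by move=> [[a' aK _] _] h; exact: ae_can aK h. Qed.

Lemma affine_infinite a Y : affine a -> infinite_set Y -> infinite_set (a @^-1` Y).
Proof.
move=> [[a' aK a'K] _] iY fY; apply: iY.
apply: sub_finite_set (finite_image a fY) => x Yx.
by exists (a' x); rewrite /= a'K.
Qed.

(** Affine maps normalise the group of left translations. *)
Lemma affine_translate a a' c Y : affine a -> cancel a' a ->
  a' @^-1` (translate c (a @^-1` Y)) = translate (a 1 * (a c^-1)^-1) Y.
Proof.
move=> [_ ha] a'K; apply/seteqP.
have e x : a (c^-1 * a' x) = (a 1 * (a c^-1)^-1)^-1 * x.
  by rewrite -{1}(mulg1 c^-1) -{1}invg1 ha a'K invgM invgK.
by split=> x; rewrite /translate /= e.
Qed.

End Affine.

Section Chains.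
Context {G : groupType}.
Implicit Types (Y Z D P : set G) (c g h x y z : G) (a : G -> G).
Hypothesis fg : finitely_generated G.
Variables (X : 'I_3 -> set G) (XP : tripartition X).
Variables (U : 'I_3 -> set (set G)) (UP : ends_in X U).
Variables (B : set G) (e y b p : G) (HB : halfspace B e y b p).
Notation m := (median U).

(** For almost all [c] the pulled back translates are nested with the pieces, so the votes force
    [a1 (q k)] into [c B] and [a2 (q k')] out of it. Only finitely many translates separate two
    given points. *)
Lemma finite_median_separation a1 a2 : affine a1 -> affine a2 ->
  finite_set [set c | m (a1 @^-1` translate c B) /\ ~ m (a2 @^-1` translate c B)].
Proof.
move=> A1 A2; have [[aB _ _ _ _] _] := HB.
have [aX iX dX cX] := XP.
have nest a : affine a -> almost_all (fun c => forall i,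
  corner (a @^-1` translate c B) (X i)).
  move=> A; have [[a' aK a'K] _] := A; have A' := affine_inv aK a'K A.
  apply: ae_forall => i; apply: aeS (nested fg aB (affine_ai A' (aX i))) => c.
  have {2}-> : X i = a @^-1` (a' @^-1` X i).
    by apply/seteqP; split => x /=; rewrite aK.
  case=> h; [apply: Or41|apply: Or42|apply: Or43|apply: Or44].
  - by rewrite -preimage_setI h preimage_set0.
  - by move=> x; exact: h.
  - by move=> x; exact: h.
  - by rewrite -preimage_setU h preimage_setT.
have ex i : exists q, ~ X i q.
  have [j ij] : exists j, j <> i.
    have [->|/eqP ni] := eqVneq i (@Ordinal 3 0 isT); last by exists (@Ordinal 3 0 isT);
      exact: nesym.
    by exists (@Ordinal 3 1 isT) => /(congr1 val).
  by have [q qj] := infinite_setN0 (iX j); exists q => qi;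
    exact: setI_disjoint (dX _ _ ij) qj qi.
have [q hq] := choice ex.
apply/finite_ae; apply: ae_mp (nest _ A1) _; apply: ae_mp (nest _ A2) _.
apply: aeS (ae_forall (fun i => ae_forall (fun j => ae_unsep (a1 (q i)) (a2 (q j)) aB))).
move=> c hsep h2 h1 [m1 m2].
have [k hk] := median_cover XP UP h1 m1; have [k' hk'] := median_sub XP UP h2 m2.
apply: (hq k'); apply: hk'; apply: hsep (k) _ _.
by apply: (setU_cover (etrans (setUC _ _) hk)); exact: hq.
Qed.

Variables (W : G) (HW : universal B W).

(* Each link of the chain contains a translate of [B] by an element of [G], however
   large the automorphisms underlying the maps [bs i] are. *)
Lemma chain_bound a1 a2 : affine a1 -> affine a2 -> exists K, forall n (bs : nat -> G -> G),
  (forall i, (i < n)%N -> affine (bs i)) ->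
  (forall i, (i.+1 < n)%N -> almost_sub (bs i @^-1` translate W B) (bs i.+1 @^-1` B)) ->
  m (a1 @^-1` (bs 0%N @^-1` B)) -> ~ m (a2 @^-1` (bs n.-1 @^-1` translate W B)) ->
    (n <= K)%N.
Proof.
move=> A1 A2; have [s es] := proj1 (finite_seqP _) (finite_median_separation A1 A2).
exists (size s) => n bs Abs step m1 m2.
have [[aB Bb eB Bp eBp] [yB iyB]] := HB.
have iB : infinite_set B by apply: infinite_sub iyB _ => x [].
have iB' : infinite_set (~` B) by apply: infinite_sub (infinite_translate e iB) _;
  exact: eB.
have ex i : exists c, (i < n)%N -> [/\ almost_sub (bs i @^-1` B) (translate c B),
    almost_sub (translate c B) (bs i @^-1` translate W B) &
      infinite_set (bs i @^-1` translate W B `\` translate c B)].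
  have [ilt|nlt] := boolP (i < n)%N; last by exists 1.
  have Ab := Abs _ ilt; have [[b' bK b'K] _] := Ab; have Ab' := affine_inv bK b'K Ab.
  have [z [z1 z2 z3]] := HW (affine_ai Ab' aB) (affine_infinite Ab' iB)
    (affine_infinite Ab' iB').
  exists (b' 1 * (b' z^-1)^-1) => _; rewrite -(affine_translate _ _ Ab' bK).
  by split; [exact: affine_asub Ab z1|exact: affine_asub Ab z2|exact:
    (affine_infinite Ab z3)].
have [c hc] := choice ex.
have up i j : (i <= j)%N -> (j < n)%N -> almost_sub (bs i @^-1` B) (bs j @^-1` B).
  elim: j => [|j IH]; first by rewrite leqn0 => /eqP-> _; exact: sub_asub.
  rewrite leq_eqVlt => /orP[/eqP-> _|]; first exact: sub_asub.
  rewrite ltnS => ij jn; apply: asub_trans (IH ij (ltnW jn)) _.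
  have [h1 h2 _] := hc _ (ltnW jn).
  by apply: asub_trans h1 _; apply: asub_trans h2 _; exact: step.
have upW i j : (i < j)%N -> (j < n)%N ->
  almost_sub (bs i @^-1` translate W B) (bs j @^-1` B).
  move=> ij jn; apply: asub_trans (up _ _ ij jn); apply: step; exact: leq_ltn_trans ij jn.
have Wn i : (i < n)%N -> almost_sub (bs i @^-1` translate W B) (bs n.-1 @^-1` translate W
  B).
  move=> ilt; have [->|ni] := eqVneq i n.-1; first exact: sub_asub.
  have nn : (n.-1 < n)%N by lia.
  have [h1 h2 _] := hc _ nn.
  apply: asub_trans (asub_trans h1 h2); apply: upW; lia.
(* Equal translates in two links would almost fill the infinite gap of the earlier link. *)
have inj i j : (i < j)%N -> (j < n)%N -> c i <> c j.
  move=> ij jn eq; have [h1 h2 h3] := hc _ (ltn_trans ij jn); have [k1 _ _] := hc _ jn.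
  apply: h3; rewrite eq; apply/finite_ae.
  by apply: aeS (asub_trans (upW _ _ ij jn) k1) => x h [/h ? +]; apply.
(* Each translate is squeezed between the two ends of the chain, so it separates the two medians. *)
have cs i : (i < n)%N -> c i \in s.
  move=> ilt; suff : [set` s] (c i) by [].
  have [h1 h2 _] := hc _ ilt.
  rewrite -es; split.
    by apply: median_mono UP _ _ (affine_asub A1 _) m1; apply: asub_trans h1; exact: up.
  by move=> h; apply: m2; apply: median_mono UP _ _ (affine_asub A2 _) h;
    apply: asub_trans h2 (Wn _ ilt).
rewrite -(size_iota 0 n) -(size_map c); apply: uniq_leq_size.
  rewrite map_inj_in_uniq ?iota_uniq // => i j; rewrite !mem_iota /= !add0n => ilt jlt eq.
  by case: (ltngtP i j) => // h; [case: (inj _ _ h jlt)|case: (inj _ _ h ilt)].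
by move=> x /mapP[i]; rewrite mem_iota /= add0n => /cs + ->.
Qed.

(** Preimages under [T'] are images under [T], so [k] annuli fit between [w B] and [T (w B)]. Powers
    of [T] carry this stack along until it meets the median, where [chain_bound] applies with a
    constant depending on [T] alone. *)
Lemma translation_bound (T T' : G -> G) : affine T -> cancel T T' -> cancel T' T ->
  exists K, forall k w, almost_sub (translate (w * W ^+ k) B) (T' @^-1` translate w B) ->
    (k <= K)%N.
Proof.
move=> AT TK T'K; have AT' := affine_inv TK T'K AT.
(* The chain will end at [bt \o T'], while the median is known to be missed at [bt \o T], two
   applications of [T] away. *)
have [K hK] := chain_bound affine_id (affine_comp AT AT).
exists K => -[//|k] w Hw; apply: contrapT => nkK.
have [[c1 mc1] [c2 mc2]] := median_translate XP UP fg HB.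
have [[aB Bb eB Bp eBp] [yB iyB]] := HB.
have iB : infinite_set B by apply: infinite_sub iyB _ => x [].
have iB' : infinite_set (~` B) by apply: infinite_sub (infinite_translate e iB) _;
  exact: eB.
have [z0 [z1 z2 _]] := HW aB iB iB'; have BW := asub_trans z1 z2.
have BWn n : almost_sub B (translate (W ^+ n) B).
  elim: n => [|n IH]; first by rewrite expg0 translate1; exact: sub_asub.
  by apply: asub_trans BW _; rewrite expgS -translateM; exact: asub_translate.
have W1 : almost_sub (translate W B) (translate (W ^+ k.+1) B) by rewrite expgS
  -translateM; exact: asub_translate.
pose H (bt : G -> G) := almost_sub (bt @^-1` translate (W ^+ k.+1) B) ((bt \o T') @^-1` B).
pose b0 : G -> G := *%g w^-1.
have Ab0 : affine b0 := affine_mul w^-1.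
have Hb0 : H b0 by rewrite -translateM in Hw.
have HT bt : H bt -> H (bt \o T).
  move=> h; have := affine_asub AT h.
  rewrite (_ : T @^-1` ((bt \o T') @^-1` B) = (bt \o T \o T') @^-1` B) //.
  by apply/seteqP; split => x /=; rewrite TK T'K.
have HT' bt : H bt -> H (bt \o T') by move=> h; exact: affine_asub AT' h.
pose f n := b0 \o iter n T'; pose g n := b0 \o iter n T.
have Af n : affine (f n) by exact: affine_comp Ab0 (affine_iter n AT').
have Ag n : affine (g n) by exact: affine_comp Ab0 (affine_iter n AT).
have fS n : f n.+1 = f n \o T' by apply/funext => x; rewrite /f /= -iterS iterSr.
have gS n : g n.+1 = g n \o T by apply/funext => x; rewrite /g /= -iterS iterSr.
have Hf n : H (f n) by elim: n => [//|n /HT']; rewrite fS.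
have Hg n : H (g n) by elim: n => [//|n /HT]; rewrite gS.
have link bt : affine bt -> H bt ->
  almost_sub (bt @^-1` translate W B) ((bt \o T') @^-1` B).
  by move=> Abt Hbt; apply: asub_trans Hbt; exact: affine_asub.
(* The preimages of [B] under [f n] and [g n] are the images of [w B] under the [n]-th powers of [T]
   and of its inverse. If the median missed all the former, or lay in all the latter, they would
   form arbitrarily long chains with fixed ends. *)
have [n1 mn1] : exists n, m (f n @^-1` B).
  apply: contrapT => nm.
  have [K1 hK1] := chain_bound (affine_mul (w * c1^-1)) affine_id.
  suff : (K1.+1 <= K1)%N by rewrite ltnn.
  apply: hK1 (f) _ _ _ _ => [i _|i _||] //.
  - by rewrite fS; exact: link.
  - rewrite (_ : _ @^-1` _ = translate c1 B) //; apply/seteqP.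
    by split=> x; rewrite /f /b0 /translate /= !mulgA mulVg mul1g.
  - move=> h; apply: nm; exists K1.+1; rewrite fS.
    by apply: (median_mono UP (link _ (Af K1) (Hf K1))); exact: h.
have [n2 mn2] : exists n, ~ m (g n @^-1` B).
  apply: contrapT => nm.
  have [K1 hK1] := chain_bound affine_id (affine_mul (w * c2^-1)).
  suff : (K1.+1 <= K1)%N by rewrite ltnn.
  have gT n : g n.+1 \o T' = g n.
    by rewrite gS; apply/funext => x /=; rewrite T'K.
  apply: hK1 (fun i => g (K1.+1 - i)%N) _ _ _ _ => [i _|i ilt||].
  - exact: Ag.
  - by have := link _ (Ag (K1.+1 - i)%N) (Hg _); rewrite subSn ?gT ?subSS //; exact: ltnW.
  - by apply: contrapT => h; apply: nm; exists (K1.+1 - 0)%N.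
  - rewrite /= subSnn => h; apply: mc2.
    have -> : translate c2 B = ( *%g (w * c2^-1)) @^-1` (g 0%N @^-1` B).
      by apply/seteqP; split=> x; rewrite /g /b0 /translate /= !mulgA mulVg mul1g.
    apply: (median_mono UP _ h); apply: affine_asub (affine_mul _) _.
    by have := link _ (Ag 1%N) (Hg _); rewrite gT.
have [bt [Abt Hbt mbt nmbt]] : exists bt, [/\ affine bt, H bt,
  m (bt @^-1` B) & ~ m ((bt \o T) @^-1` B)].
  (* The bijection [bt] is taken at the first crossing on the way from [g n2] to [f n1]. *)
  pose q n := g n2 \o iter n T'.
  have Aq n : affine (q n) by exact: affine_comp (Ag _) (affine_iter n AT').
  have qS n : q n.+1 = q n \o T' by apply/funext => x; rewrite /q /= -iterS iterSr.
  have Hq n : H (q n) by elim: n => [|n /HT']; [exact: Hg|rewrite qS].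
  have exq : exists n, `[< m (q n @^-1` B) >].
    exists (n2 + n1)%N; apply/asboolP; rewrite (_ : q _ = f n1) //.
    apply/funext => x; rewrite /q /g /f /= iterD; congr (_ * _).
    by elim: n2 {mn2 q Aq qS Hq} (iter n1 T' x) => //= n IH v;
      rewrite -iterS iterSr /= T'K IH.
  case: (ex_minnP exq) => -[|n] /asboolP mn minn; first by case: mn2.
  exists (q n.+1); split => // h.
  have : (n.+1 <= n)%N; last by rewrite ltnn.
  apply: minn; apply/asboolP; rewrite (_ : q n = q n.+1 \o T) // qS.
  by apply/funext => x /=; rewrite TK.
apply: nkK; apply: (hK k.+1 (fun i => ( *%g (W ^- i)) \o bt)) => [i _|i _||] //.
- exact: affine_comp (affine_mul _) Abt.
- apply: sub_asub => x; rewrite /translate /= mulgA -invgM.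
  by rewrite -expgSr.
- rewrite (_ : _ @^-1` _ = bt @^-1` B) //.
  by apply/seteqP; split => x /=; rewrite expg0 invg1 mul1g.
- move=> h; apply: nmbt.
  have := affine_asub (affine_comp AT AT) Hbt => hh.
  have e1 : (T \o T) @^-1` ((bt \o T') @^-1` B) = (bt \o T) @^-1` B.
    by apply/seteqP; split => x /=; rewrite TK.
  rewrite -e1; apply: (median_mono UP hh).
  rewrite (_ : (T \o T) @^-1` _ = (T \o T) @^-1` (( *%g (W ^- k) \o bt) @^-1` translate W
    B)) //.
  by apply/seteqP; split => x; rewrite /translate /= mulgA -invgM -expgSr.
Qed.

End Chains.

(** * Twisted conjugacy classes *)

Lemma infinitely_many_ends_R_infty (G : groupType) : infinitely_many_ends G -> R_infty G.
Proof.
move=> ieG phi [phi' phiK phi'K] fin.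
have [fg _] := many_ends 0 ieG.
have [X XP] := tripartition_ex ieG; have [U UP] := ends_in_ex XP.
have [B [e [y [b [p HB]]]]] := halfspace_ex ieG.
have [[aB Bb eB Bp eBp] [yB iyB]] := HB.
have iB : infinite_set B by apply: infinite_sub iyB _ => x [].
have [W HW] := universal_annulus fg aB Bb eB Bp eBp yB iyB.
have phi1 : phi 1 = 1 by apply: (mulgI (phi 1)); rewrite -gmulfM !mulg1.
have phiV x : phi x^-1 = (phi x)^-1.
  by apply/esym/mulg1_eq; rewrite -gmulfM mulgV.
have Aphi : affine phi.
  by split; [exists phi'|move=> x z t; rewrite !gmulfM phiV].
have Aphi' := affine_inv phiK phi'K Aphi.
(* The preimage of [B] under [phi'] is [phi B], so [u B] lies in [phi B]. *)
have [u uB] := deep_translate_ex fg aB Bb eB Bp eBp (affine_ai Aphi' aB) (affine_infinite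
  Aphi' iB).
pose x_ k := u * W ^- k.
pose T x v := x^-1 * phi v; pose T' x v := phi' (x * v).
have TK x : cancel (T x) (T' x) by move=> v; rewrite /T /T' mulVKg phiK.
have T'K x : cancel (T' x) (T x) by move=> v; rewrite /T /T' phi'K mulKg.
have AT x : affine (T x) := affine_comp (affine_mul _) Aphi.
pose cl x := [set y | twisted_conj phi x y].
have cl_refl x : cl x x by exists 1; rewrite phi1 mul1g invg1 mulg1.
(* Each class contains [x_ k] for finitely many [k] only, so finitely many classes cannot exhaust
   all [k]. *)
have fiber c : finite_set [set k | cl (x_ k) = c].
  have [[k0 <-]|nk] := pselect (exists k0, cl (x_ k0) = c); last first.
    by rewrite (_ : [set _ | _] = set0) // -subset0 => k /= h; apply: nk; exists k.
  have [K hK] := translation_bound fg XP UP HB HW (AT (x_ k0)) (TK _) (T'K _).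
  apply: sub_finite_set (_ : _ `<=` `I_K.+1) (finite_II _) => k /= ek.
  have [w ew] : cl (x_ k0) (x_ k) by rewrite -ek.
  rewrite ltnS; apply: (hK k w^-1); apply: sub_asub => v.
  rewrite /translate /= invgM invgK /T' => Bv.
  (* The twisted conjugacy [phi w * x_ k0 * w^-1 = x_ k] says that left translation by [w]
     conjugates [T' (x_ k0)] into [T' (x_ k)]. *)
  have -> : w * phi' (x_ k0 * v) = phi' (u * (W ^- k * w * v)).
    by apply: (can_inj phiK); rewrite gmulfM !phi'K mulgA -(mulgVK w (phi w * x_ k0)) ew
      !mulgA.
  by apply: uB; rewrite translate_mul.
apply: infinite_nat.
rewrite (_ : setT = \bigcup_(c in twisted_classes phi) [set k | cl (x_ k) = c]).
  by apply: bigcup_finite.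
by apply/seteqP; split => // k _; exists (cl (x_ k)) => //; exists (x_ k).
Qed.

Theorem theorem5p1p18 :
  (forall G : groupType,
     accessible G -> infinitely_many_ends G -> R_infty G) /\
  (forall G : groupType,
     finitely_presented G -> infinitely_many_ends G -> R_infty G).
Proof. by split=> G _; exact: infinitely_many_ends_R_infty. Qed.
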